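(* Let $p$ be an odd prime, $e\ge1$, and let $\mathcal M$ be an orientably-regular embedding of $K_{p[p^e]}$ with $G=\mathrm{Aut}^+(\mathcal M)$, $H$ the subgroup of $G$ of automorphisms preserving each of the $p$ parts setwise, and $P$ a Sylow $p$-subgroup of $G$. Let $f\in\{1,\dots,e\}$ be the integer such that $H\cong\langle x,z\mid x^{p^e}=z^{p^e}=1,\ z^x=z^{1+p^f}\rangle$. If $H$ is nonabelian and $P$ has exponent $p^e$, then $p=3$ and $f=e-1$.
   Context: $K_{m[n]}$ is the complete multipartite graph with $m$ parts of $n$ vertices each; an orientably-regular embedding of it is an orientable map with this underlying graph whose group $\mathrm{Aut}^+(\mathcal M)$ of orientation-preserving automorphisms acts regularly on arcs. It is known that in this situation $H$ is isomorphic to a group $\langle x,z\mid x^{p^e}=z^{p^e}=1,\ z^x=z^{1+p^f}\rangle$ for a unique $f\in\{1,\dots,e\}$ (different $f$ give non-isomorphic groups; $H$ is abelian iff $f=e$). Conjugation is $z^x=x^{-1}zx$. *)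

(* Defs.v *)
From mathcomp Require Import all_boot all_fingroup all_solvable.
Set Implicit Arguments. Unset Strict Implicit. Unset Printing Implicit Defensive.
Local Open Scope group_scope.

(* An orientable map on the dart (arc) set D: R is the rotation (successor of a
   dart around its initial vertex), L the fixed-point-free involution reversing
   each dart; the monodromy group <R, L> is transitive (connectedness).
   Vertices = orbits of <[R]>, edges = orbits of <[L]>; dart d joins the vertex
   of d to the vertex of L d. *)
Definition orientable_map (D : finType) (R L : {perm D}) : Prop :=
  [/\ forall d, L d != d,
      forall d, L (L d) = d &
      forall d d', exists2 g, g \in <<[set R; L]>> & g d = d'].

Definition AutP (D : finType) (R L : {perm D}) : {group {perm D}} :=
  'C([set R; L])%G.

Definition orientably_regular (D : finType) (R L : {perm D}) : Prop :=
  [/\ orientable_map R L,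
      forall d d', exists2 g, g \in AutP R L & g d = d' &
      forall g d, g \in AutP R L -> g d = d -> g = 1].

(* The underlying graph of the map is K_{m[n]}: phi labels each dart by its
   initial vertex, identifying vertices (R-orbits) bijectively with
   'I_m * 'I_n (part, index in part); there is exactly one dart from u to v
   when u, v lie in different parts and none otherwise (no loops). *)
Definition embeds_Kmn (m n : nat) (D : finType) (R L : {perm D})
    (phi : D -> 'I_m * 'I_n) : Prop :=
  [/\ forall d, phi (R d) = phi d,
      forall d d', phi d = phi d' -> exists k, (R ^+ k) d = d',
      forall v, exists d, phi d = v,
      forall d, (phi d).1 != (phi (L d)).1 &
      forall u v, u.1 != v.1 ->
        #|[set d | (phi d == u) && (phi (L d) == v)]| = 1%N].

Definition part_preserving (m n : nat) (D : finType) (R L : {perm D})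
    (phi : D -> 'I_m * 'I_n) : {set {perm D}} :=
  [set g in AutP R L | [forall d, (phi (g d)).1 == (phi d).1]].

(* Main.v *)
(* Stabilisers in H of vertices in different parts are cyclic of order p^e and
   meet trivially, so |H| = p^(2e) and H is the split extension <x><z>.  An
   element c of P outside H moves some part, and c^p lies in H.  Since P has
   exponent p^e, c^p lies in Mho^1(H), hence commutes with x
   modulo Mho^2(H).  Write z^c = x^(p b) z^(1 + p a) and
   x^c = x^(1 + p g) z^d.  Vertex stabilisers in different parts being disjoint,
   p does not divide d.  Iterating c on x modulo Mho^2(H) gives
   x^(c^p) = x (z^p)^(d + d^2 b C(p, 3)), so p divides 1 + d b C(p, 3): this is
   impossible for p > 3, and for p = 3 it forces b prime to 3, whereas p^(e - f)
   always divides p b. *)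
Require Import Defs.
From mathcomp Require Import all_boot all_fingroup all_solvable.
From mathcomp Require Import ring.
Local Open Scope group_scope.
Set Implicit Arguments.
Unset Strict Implicit.

(** * Powers and geometric sums with ratio congruent to 1 *)

Lemma expn_add1_mod2 a n : exists w, ((1 + a) ^ n = 1 + n * a + a ^ 2 * w)%N.
Proof.
elim: n => [|n [w IHn]]; first by exists 0%N; rewrite muln0.
by exists (w + n + a * w)%N; rewrite expnS IHn -addn1; ring.
Qed.

Lemma geom_sum_mod2 a n :
  exists w, (\sum_(k < n) (1 + a) ^ k = n + a * 'C(n, 2) + a ^ 2 * w)%N.
Proof.
elim: n => [|n [w IHn]]; first by exists 0%N; rewrite big_ord0 bin0n !muln0.
have [w' Dw'] := expn_add1_mod2 a n.
by exists (w + w')%N; rewrite big_ord_recr IHn Dw' binS bin1 -addn1 /=; ring.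
Qed.

(** Cut the sum into blocks of length [p]: it factors as one block times a sum of length
    [p ^ (m - 1)] with ratio [(1 + p * r) ^ p], which is again 1 modulo [p]. Oddness of [p] makes
    ['C(p, 2)] a multiple of [p], so each block is [p] times a number congruent to 1 modulo [p]. *)
Lemma geom_sum_prime_power p r m : odd p ->
  exists s, (\sum_(k < p ^ m) (1 + p * r) ^ k = p ^ m * (1 + p * s))%N.
Proof.
move=> odd_p; elim: m r => [|m IHm] r.
  by exists 0%N; rewrite expn0 big_ord1 !muln0.
have [w Dw] := geom_sum_mod2 (p * r) p.
have [r' Dr']: exists r', ((1 + p * r) ^ p = 1 + p * r')%N.
  have [w' ->] := expn_add1_mod2 (p * r) p.
  by exists (p * r + p * r ^ 2 * w')%N; ring.
have [s Ds] := IHm r'.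
have split_sum n : (\sum_(k < p * n) (1 + p * r) ^ k =
    (\sum_(k < p) (1 + p * r) ^ k) * \sum_(k < n) (1 + p * r') ^ k)%N.
  elim: n => [|n IHn]; first by rewrite muln0 !big_ord0 muln0.
  rewrite mulnS addnC big_split_ord /= IHn big_ord_recr mulnDr; congr addn.
  rewrite big_distrl /=; apply: eq_bigr => k _.
  by rewrite expnD mulnC expnM Dr'.
(* With ['C(p, 2) = p * p.-1./2], the block is [p * (1 + p * v)] for [v = r * p.-1./2 + r ^ 2 * w];
   the witness [v + s + p * s * v] comes from expanding [(1 + p * v) * (1 + p * s)]. *)
exists (r * p.-1./2 + r ^ 2 * w + s + p * s * (r * p.-1./2 + r ^ 2 * w))%N.
rewrite expnS split_sum Ds Dw bin2odd //; ring.
Qed.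

(** [A] and [B] will be the [p]-th powers of [X] and [Z] modulo ['Mho^2(H)]. Each conjugation lets
    [X] shed copies of [Z], [Z] copies of [A], and [A] copies of [B]; summing along this chain with
    Pascal's rule produces ['C(k, 2)] and then ['C(k, 3)]. *)
Lemma conjg_iter_relation (gT : finGroupType) (X Z A B c : gT) (a b g d : nat) :
  commute Z A -> commute Z B -> commute A B ->
  X ^ c = X * Z ^+ d * A ^+ g -> Z ^ c = Z * A ^+ b * B ^+ a ->
  A ^ c = A * B ^+ d -> B ^ c = B ->
  forall k, X ^ (c ^+ k) =
    X * Z ^+ (k * d) * A ^+ (k * g + b * d * 'C(k, 2))
      * B ^+ ('C(k, 2) * (d * (g + a)) + d ^ 2 * b * 'C(k, 3)).
Proof.
move=> cZA cZB cAB Xc Zc Ac Bc; elim=> [|k IHk].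
  by rewrite conjg1 !bin0n !mul0n !muln0 !mulg1.

rewrite expgSr conjgM IHk !conjMg !conjXg Xc Zc Ac Bc.
set m := (k * d)%N; set T := (_ + _ * 'C(k, 2))%N.
set S := (_ + _ * 'C(k, 3))%N.
have cZAB: commute (Z * A ^+ b) (B ^+ a).
  by apply/commute_sym/commuteM; apply/commute_sym; [exact: commuteX | exact: commuteX2].
rewrite (expgMn _ cZAB) (expgMn m (commuteX b cZA)) (expgMn T (commuteX d cAB)).
rewrite -!expgM -!mulgA; congr (X * _).
rewrite (mulgA (A ^+ g)) -(commuteX2 m g cZA) -(mulgA (Z ^+ m)).
rewrite (mulgA (B ^+ (a * m))) -(commuteX2 T (a * m) cAB) -(mulgA (A ^+ T)).
rewrite (mulgA (Z ^+ d)) (mulgA (A ^+ (b * m))) (mulgA (A ^+ g)) -!expgD.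
congr (_ * (_ ^+ _ * _ ^+ _)).
  by rewrite /T /m binS bin1 mulSn; ring.
by rewrite /S /T /m (binS k 2) (binS k 1) bin1; ring.
Qed.

(** * The split metacyclic group [H], of order [p ^ (2 * e)] *)

Section SplitMetacyclic.

Variables (gT : finGroupType) (p e f : nat) (H : {group gT}) (x z : gT).
Let t := (1 + p ^ f)%N.
Hypotheses (pr_p : prime p) (odd_p : odd p) (f_gt0 : (0 < f)%N).
Hypothesis defH : <[x]> <*> <[z]> = H.
Hypotheses (xq : x ^+ (p ^ e) = 1) (zq : z ^+ (p ^ e) = 1).
Hypothesis zx : z ^ x = z ^+ t.
Hypothesis oH : #|H| = (p ^ e * p ^ e)%N.

Lemma metacyclic_mem_x : x \in H.
Proof. by rewrite -defH mem_gen // inE cycle_id. Qed.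

Lemma metacyclic_mem_z : z \in H.
Proof. by rewrite -defH mem_gen // inE cycle_id orbT. Qed.

Lemma metacyclic_conj_z i j l : (z ^+ j) ^ (x ^+ i * z ^+ l) = z ^+ (j * t ^ i).
Proof.
have zxi k : z ^ (x ^+ k) = z ^+ (t ^ k).
  elim: k => [|k IHk]; first by rewrite conjg1.
  by rewrite expgSr conjgM IHk conjXg zx -expgM expnS.
by rewrite conjgM conjXg zxi -expgM mulnC conjgE (commuteX2 _ _ (commute_refl z)) mulKg.
Qed.

(** This makes [<[x ^+ (p ^ m)]> * <[z ^+ (p ^ m)]>] a group; the case [m = 0] gives the
    factorisation of [H] itself. *)
Lemma metacyclic_pow_norm m : <[x ^+ (p ^ m)]> \subset 'N(<[z ^+ (p ^ m)]>).
Proof.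
rewrite cycle_subG; apply/normP; apply/eqP; rewrite eqEcard cardJg leqnn andbT.
rewrite -cycleJ cycle_subG -[x ^+ _]mulg1 -[1](expg0 z) metacyclic_conj_z expgM.
exact: mem_cycle.
Qed.

Lemma metacyclic_mulE : <[x]> * <[z]> = H.
Proof.
by rewrite -defH norm_joinEl // -[x]expg1 -[z]expg1 -(expn0 p) metacyclic_pow_norm.
Qed.

Lemma metacyclic_expP h : h \in H -> exists i j, h = x ^+ i * z ^+ j.
Proof.
rewrite -metacyclic_mulE => /mulsgP[_ _ /cycleP[i ->] /cycleP[j ->] ->].
by exists i, j.
Qed.

(** The relations bound both orders by [p ^ e], and the order of [H] leaves no slack in the product
    formula. *)
Lemma metacyclic_orders :
  [/\ #[x] = (p ^ e)%N, #[z] = (p ^ e)%N & <[x]> :&: <[z]> = 1].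
Proof.
have q_gt0 : (0 < p ^ e)%N by rewrite expn_gt0 prime_gt0.
have ox : (#[x] <= p ^ e)%N by rewrite dvdn_leq // order_dvdn xq.
have oz : (#[z] <= p ^ e)%N by rewrite dvdn_leq // order_dvdn zq.
have := mul_cardG <[x]> <[z]>; rewrite metacyclic_mulE oH -!orderE => oXZ.
have I_gt0 := cardG_gt0 (<[x]> :&: <[z]>).
have leXZ : (#[x] * #[z] <= p ^ e * p ^ e)%N by rewrite leq_mul.
have I1 : #|<[x]> :&: <[z]>| = 1%N.
  apply/eqP; rewrite eqn_leq I_gt0 andbT.
  rewrite -(leq_pmul2l (m := p ^ e * p ^ e)%N) ?muln_gt0 ?q_gt0 //.
  by rewrite -oXZ muln1.
rewrite I1 muln1 in oXZ; split; last exact: card1_trivg.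
  apply/eqP; rewrite eqn_leq ox -(leq_pmul2r q_gt0) -oXZ.
  by rewrite leq_mul2l oz orbT.
apply/eqP; rewrite eqn_leq oz -(leq_pmul2l q_gt0) -oXZ.
by rewrite leq_mul2r ox orbT.
Qed.

Lemma metacyclic_exp_inj i j k l :
  x ^+ i * z ^+ j = x ^+ k * z ^+ l -> i = k %[mod p ^ e] /\ j = l %[mod p ^ e].
Proof.
have [ox oz tiXZ] := metacyclic_orders => eq_xz.
have: x ^- k * x ^+ i = 1.
  apply/set1gP; rewrite -tiXZ inE groupM ?groupV ?mem_cycle //=.
  have -> : x ^- k * x ^+ i = z ^+ l * z ^- j.
    by apply: (mulIg (z ^+ j)); rewrite -mulgA eq_xz mulKg mulgKV.
  by rewrite groupM ?groupV ?mem_cycle.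
move/(canRL (mulKVg _)); rewrite mulg1 => eq_x.
split; apply/eqP; first by rewrite -ox -eq_expg_mod_order eq_x.
rewrite -oz -eq_expg_mod_order; apply/eqP/(mulgI (x ^+ k)).
by rewrite -eq_xz eq_x.
Qed.

(** Collecting powers of [x] on the left leaves [z] with a geometric sum of ratio [t ^ i], which is
    1 modulo [p] because [f] is positive. *)
Lemma metacyclic_pow_prime m i j : exists s,
  (x ^+ i * z ^+ j) ^+ (p ^ m) = x ^+ (i * p ^ m) * z ^+ (j * p ^ m * (1 + p * s)).
Proof.
have powE n : (x ^+ i * z ^+ j) ^+ n =
    x ^+ (i * n) * z ^+ (j * \sum_(k < n) (t ^ i) ^ k).
  elim: n => [|n IHn]; first by rewrite big_ord0 !muln0 mulg1.
  have := metacyclic_conj_z i (j * \sum_(k < n) (t ^ i) ^ k) 0; rewrite mulg1 => zxi.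
  rewrite expgSr IHn -mulgA (mulgA (z ^+ _)) (conjgC _ (x ^+ i)) zxi.
  rewrite !mulgA -expgD -mulgA -expgD -mulnSr -mulnA -mulnSr big_ord_recl expn0.
  congr (_ * _ ^+ (_ * _)); rewrite big_distrl add1n; congr _.+1.
  by apply: eq_bigr => k _; rewrite expnSr.
have [r Dr] : exists r, (t ^ i = 1 + p * r)%N.
  have [w Dw] := expn_add1_mod2 (p ^ f) i.
  exists (i * p ^ f.-1 + p ^ f.-1 * p ^ f * w)%N.
  by rewrite Dw -(prednK f_gt0) expnS /=; ring.
have [s Ds] := geom_sum_prime_power r m odd_p.
by exists s; rewrite powE Dr Ds mulnA.
Qed.

Lemma metacyclic_pgroup : p.-group H.
Proof. by rewrite /pgroup oH pnatM pnatX pnat_id. Qed.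

(** By the power formula every [p ^ m]-th power lies in the group [<[x ^+ (p ^ m)]> *
    <[z ^+ (p ^ m)]>]. Exponents are only determined modulo [p ^ e], whence the bound on [m]. *)
Lemma metacyclic_mem_Mho m i j : (m <= e)%N ->
  (x ^+ i * z ^+ j \in 'Mho^m(H)) = (p ^ m %| i)%N && (p ^ m %| j)%N.
Proof.
move=> le_me; apply/idP/andP=> [|[/dvdnP[i' ->] /dvdnP[j' ->]]]; last first.
  have memMho h n : h \in H -> h ^+ (n * p ^ m) \in 'Mho^m(H).
    by move=> Hh; rewrite mulnC expgM groupX // Mho_p_elt // (mem_p_elt metacyclic_pgroup).
  by rewrite groupM // memMho ?metacyclic_mem_x ?metacyclic_mem_z.
have sMho : 'Mho^m(H) \subset <[x ^+ (p ^ m)]> * <[z ^+ (p ^ m)]>.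
  rewrite -norm_joinEl ?metacyclic_pow_norm // (MhoE _ metacyclic_pgroup) gen_subG.
  apply/subsetP=> _ /imsetP[h /metacyclic_expP[k [l ->]] ->].
  have [s ->] := metacyclic_pow_prime m k l.
  rewrite [(k * _)%N]mulnC [(l * _)%N]mulnC -mulnA (expgM x) (expgM z).
  by rewrite groupM // mem_gen // inE mem_cycle ?orbT.
move/(subsetP sMho)=> /mulsgP[_ _ /cycleP[k ->] /cycleP[l ->]].
rewrite -!expgM => /metacyclic_exp_inj[eq_i eq_j].
have dv n k' : n = (p ^ m * k')%N %[mod p ^ e] -> (p ^ m %| n)%N.
  have dvd_me : (p ^ m %| p ^ e)%N by rewrite dvdn_exp2l.
  by rewrite /dvdn -(modn_dvdm n dvd_me) => ->; rewrite modn_dvdm // modnMr.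
by split; [apply: dv eq_i | apply: dv eq_j].
Qed.

Lemma metacyclic_coset_eq1 m i j : (m <= e)%N ->
  (coset 'Mho^m(H) x ^+ i * coset 'Mho^m(H) z ^+ j == 1)
    = (p ^ m %| i)%N && (p ^ m %| j)%N.
Proof.
move=> le_me.
have nKH : H \subset 'N('Mho^m(H)) by rewrite gFnorm.
have [nKx nKz] := (subsetP nKH x metacyclic_mem_x, subsetP nKH z metacyclic_mem_z).
rewrite -!morphX // -morphM ?groupX // -metacyclic_mem_Mho //.
apply/eqP/idP; last exact: coset_id.
by apply: coset_idr; rewrite groupM ?groupX.
Qed.

(* [z ^+ (p ^ f)] generates [H^`(1)], which [c] normalises and [<[z]>] contains. *)
Lemma metacyclic_conj_div c b a : (f < e)%N -> c \in 'N(H) ->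
  z ^ c = x ^+ b * z ^+ a -> (p ^ (e - f) %| b)%N.
Proof.
move=> lt_fe nHc zc; have [ox _ _] := metacyclic_orders.
have sH'Z : H^`(1) \subset <[z]>.
  have nZx : <[x]> \subset 'N(<[z]>).
    by have := metacyclic_pow_norm 0; rewrite expn0 !expg1.
  rewrite -defH der1_min //=.
    by rewrite join_subG nZx normG.
  by rewrite /= joingC quotientYidl // quotient_abelian // cycle_abelian.
have zpf : z ^+ (p ^ f) \in H^`(1).
  have -> : z ^+ (p ^ f) = [~ z, x] by rewrite commgEl zx expgD mulKg.
  by rewrite mem_commg ?metacyclic_mem_x ?metacyclic_mem_z.
have: (z ^ c) ^+ (p ^ f) \in <[z]>.
  apply: (subsetP sH'Z); rewrite -conjXg memJ_norm //.
  by apply: subsetP nHc; exact: gFnorms.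
have [s Dz] := metacyclic_pow_prime f b a; rewrite zc Dz groupMr ?mem_cycle // => Zx.
(* Since [<[x]>] and [<[z]>] meet trivially, membership in [<[z]>] kills the [x]-part, so [p ^ e]
   divides [b * p ^ f]. *)
have: x ^+ (b * p ^ f) == 1.
  by apply/eqP/set1gP; have [_ _ <-] := metacyclic_orders; rewrite inE mem_cycle.
rewrite -order_dvdn ox -{1}(subnK (ltnW lt_fe)) expnD dvdn_pmul2r //.
by rewrite expn_gt0 prime_gt0.
Qed.

(** * The action of a normalising element [c] on quotients of [H] *)

(** On the elementary abelian quotient by ['Mho^1(H)], [c] acts by a triangular matrix with diagonal
    [g], [a], whose [p]-th power is the identity; Fermat's little theorem then gives both diagonal
    entries. *)
Lemma metacyclic_conj_unipotent c g d b a : (0 < e)%N -> c \in 'N(H) ->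
    c ^+ p \in 'Mho^1(H) -> x ^ c = x ^+ g * z ^+ d -> z ^ c = x ^+ b * z ^+ a ->
  (p %| b)%N -> g = 1 %[mod p] /\ a = 1 %[mod p].
Proof.
move=> e_gt0 nHc cpK xc zc p_b; set K := 'Mho^1(H) in cpK *.
have nKH : H \subset 'N(K) by rewrite gFnorm.
have nKc : c \in 'N(K) by apply: subsetP nHc; exact: gFnorms.
have [nKx nKz] := (subsetP nKH x metacyclic_mem_x, subsetP nKH z metacyclic_mem_z).
pose X := coset K x; pose Z := coset K z; pose C := coset K c.
have eq1 i j : (X ^+ i * Z ^+ j == 1) = (p %| i)%N && (p %| j)%N.
  by rewrite metacyclic_coset_eq1.
have oX : #[X] = p.
  apply/eqP; rewrite eqn_dvd order_dvdn -[X ^+ p]mulg1 -[1](expg0 Z) eq1 dvdnn dvdn0.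
  by have := eq1 #[X] 0; rewrite expg_order mulg1 eqxx dvdn0 andbT => <-.
have oZ : #[Z] = p.
  apply/eqP; rewrite eqn_dvd order_dvdn -[Z ^+ p]mul1g -{1}[1](expg0 X) eq1 dvdnn dvdn0.
  by have := eq1 0 #[Z]; rewrite expg_order mulg1 eqxx dvdn0 => <-.
have Cp : C ^+ p = 1 by rewrite -morphX //; apply: coset_id.
have Xc : X ^ C = X ^+ g * Z ^+ d by rewrite -morphJ // xc morphM ?morphX ?groupX.
have Zc : Z ^ C = Z ^+ a.
  rewrite -morphJ // zc morphM ?morphX ?groupX //= -/X -/Z.
  by rewrite (_ : X ^+ b = 1) ?mul1g //; apply/eqP; rewrite -order_dvdn oX.
have fermat n m : n = 1 %[mod p] -> n = m ^ p %[mod p] -> m = 1 %[mod p].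
  by move=> <- ->; rewrite fermat_little.
have ZCk k : Z ^ (C ^+ k) = Z ^+ (a ^ k).
  elim: k => [|k IHk]; first by rewrite conjg1.
  by rewrite expgSr conjgM IHk conjXg Zc -expgM expnS.
have cXZ : commute X Z.
  apply: commute_sym; apply/commgP/conjg_fixP; rewrite -morphJ // zx morphX //= -/Z.
  apply/eqP; rewrite -[X in _ == X]expg1 eq_expg_mod_order oZ /t -(prednK f_gt0) expnS.
  by rewrite mulnC addnC modnMDl.
have XCk k : exists l, X ^ (C ^+ k) = X ^+ (g ^ k) * Z ^+ l.
  elim: k => [|k [l IHk]]; first by exists 0%N; rewrite conjg1 mulg1.
  exists (d * g ^ k + a * l)%N; rewrite expgSr conjgM IHk conjMg !conjXg Xc Zc.
  by rewrite (expgMn _ (commuteX2 g d cXZ)) -!expgM -mulgA -expgD expnS.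
split; apply: (fermat 1%N) => //; apply/eqP; last first.
  by have:= eq_expg_mod_order Z 1 (a ^ p); rewrite oZ => <-; rewrite -ZCk Cp conjg1.
have [l] := XCk p; rewrite Cp conjg1 => DX.
(* Adding [p.-1] to both sides turns the congruence into divisibility of [g ^ p + p.-1] by [p],
   without subtraction. *)
rewrite -(eqn_modDr p.-1) add1n prednK ?prime_gt0 // modnn eq_sym.
have: X ^+ (g ^ p + p.-1) * Z ^+ l == 1.
  rewrite addnC expgD -mulgA -DX -expgSr prednK ?prime_gt0 //.
  by rewrite -order_dvdn oX.
by rewrite eq1 => /andP[].
Qed.

(* If [p] divided [d], then [c] would centralise all [p ^ e.-1]-th powers, so
   that [u] and [u ^ c] would have a nontrivial common power. *)
Lemma metacyclic_conj_ndvd c u g d b a : (0 < e)%N -> c \in 'N(H) ->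
    x ^ c = x ^+ g * z ^+ d -> z ^ c = x ^+ b * z ^+ a -> (p %| b)%N ->
    g = 1 %[mod p] -> a = 1 %[mod p] ->
    u \in H -> #[u] = (p ^ e)%N -> <[u]> :&: <[u ^ c]> = 1 -> ~~ (p %| d)%N.
Proof.
move=> e_gt0 nHc xc zc p_b g1 a1 Hu ou tiu; apply/negP=> p_d.
set r := (p ^ e.-1)%N; have rp : (r * p = p ^ e)%N by rewrite -expnSr prednK.
(* [y ^+ r] has order dividing [p], so its exponents matter only modulo [p]. *)
have pow_mod (y : gT) m n :
    y ^+ (p ^ e) = 1 -> m = n %[mod p] -> y ^+ (m * r) = y ^+ (n * r).
  move=> yq eq_mn; rewrite ![(_ * r)%N]mulnC !expgM.
  have yrp : (y ^+ r) ^+ p = 1 by rewrite -expgM rp.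
  by rewrite -(expg_mod m yrp) eq_mn expg_mod.
have powr i j : (x ^+ i * z ^+ j) ^+ r = x ^+ (i * r) * z ^+ (j * r).
  have [s ->] := metacyclic_pow_prime e.-1 i j; congr (_ * _).
  rewrite mulnAC; apply: pow_mod => //.
  by rewrite mulnDr muln1 mulnCA mulnC addnC modnMDl.
have xrc : (x ^+ r) ^ c = x ^+ r.
  rewrite conjXg xc powr (pow_mod x g 1%N) // (pow_mod z d 0%N) ?mul1n ?mulg1 //.
  by rewrite mod0n; apply/eqP.
have zrc : (z ^+ r) ^ c = z ^+ r.
  rewrite conjXg zc powr (pow_mod z a 1%N) // (pow_mod x b 0%N) ?mul1n ?mul1g //.
  by rewrite mod0n; apply/eqP.
have [i [j Du]] := metacyclic_expP Hu.
have urc : (u ^ c) ^+ r = u ^+ r.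
  rewrite -conjXg Du powr conjMg [(i * r)%N]mulnC [(j * r)%N]mulnC !expgM.
  by rewrite (conjXg (x ^+ r)) (conjXg (z ^+ r)) xrc zrc.
have /eqP: u ^+ r = 1 by apply/set1gP; rewrite -tiu inE mem_cycle -urc mem_cycle.
rewrite -order_dvdn ou => /dvdn_leq; rewrite expn_gt0 prime_gt0 // leqNgt ltn_exp2l.
  by rewrite prednK // leqnn => /(_ isT).
exact: prime_gt1.
Qed.

(** The factor [1 + p * s] of the power formula is prime to [p], so it cannot help [j] reach
    divisibility. This is how the exponent of [P] places [c ^+ p] in ['Mho^1(H)]. *)
Lemma metacyclic_pow_eq1 h : (0 < e)%N -> h \in H -> h ^+ (p ^ e.-1) = 1 ->
  exists i j, h = x ^+ (p * i) * z ^+ (p * j).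
Proof.
move=> e_gt0 Hh hr1; have [ox oz _] := metacyclic_orders.
have [i [j Dh]] := metacyclic_expP Hh.
have [s Dhr] := metacyclic_pow_prime e.-1 i j; rewrite -Dh hr1 in Dhr.
have r_gt0 : (0 < p ^ e.-1)%N by rewrite expn_gt0 prime_gt0.
have /dvdnP[i' Di] : (p %| i)%N.
  have := @metacyclic_exp_inj 0 0 (i * p ^ e.-1) (j * p ^ e.-1 * (1 + p * s)).
  rewrite !expg0 mulg1 => /(_ Dhr)[/esym/eqP + _].
  by rewrite mod0n -/(dvdn _ _) -{1}(prednK e_gt0) expnS dvdn_pmul2r.
have /dvdnP[j' Dj] : (p %| j)%N.
  have := @metacyclic_exp_inj 0 0 (i * p ^ e.-1) (j * p ^ e.-1 * (1 + p * s)).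
  rewrite !expg0 mulg1 => /(_ Dhr)[_ /esym/eqP].
  rewrite mod0n -/(dvdn _ _) -{1}(prednK e_gt0) expnS mulnAC dvdn_pmul2r //.
  rewrite Gauss_dvdl // prime_coprime // dvdn_addl ?dvdn_mulr //.
  by rewrite dvdn1 neq_ltn prime_gt1 ?orbT.
by exists i', j'; rewrite Dh Di Dj ![(_ * p)%N]mulnC.
Qed.

(** Modulo ['Mho^2(H)] the element [c ^+ p] centralises [x], so the iteration formula at [k = p]
    must return [X]; the congruence is read off the exponent of [B]. *)
Lemma metacyclic_conj_congruence c g d b a : (1 < e)%N -> c \in 'N(H) ->
    c ^+ p \in 'Mho^1(H) ->
    x ^ c = x ^+ (1 + p * g) * z ^+ d -> z ^ c = x ^+ (p * b) * z ^+ (1 + p * a) ->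
  (p %| d * (1 + d * b * 'C(p, 3)))%N.
Proof.
move=> e_gt1 nHc cpK1 xc zc; set K := 'Mho^2(H).
have p_gt0 := prime_gt0 pr_p.
have nKH : H \subset 'N(K) by rewrite gFnorm.
have nKc : c \in 'N(K) by apply: subsetP nHc; exact: gFnorms.
have [nKx nKz] := (subsetP nKH x metacyclic_mem_x, subsetP nKH z metacyclic_mem_z).
pose X := coset K x; pose Z := coset K z; pose C := coset K c.
have eq1 i j : (X ^+ i * Z ^+ j == 1) = (p ^ 2 %| i)%N && (p ^ 2 %| j)%N.
  by rewrite metacyclic_coset_eq1.
pose A := X ^+ p; pose B := Z ^+ p.
have Ap : A ^+ p = 1.
  by apply/eqP; have := eq1 (p ^ 2)%N 0; rewrite mulg1 dvdnn dvdn0 expnS expn1 expgM.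
have Bp : B ^+ p = 1.
  by apply/eqP; have := eq1 0 (p ^ 2)%N; rewrite mul1g dvdnn dvdn0 expnS expn1 expgM.
have cZB : commute Z B by exact: commuteX.
have cosetE i j : coset K (x ^+ i * z ^+ j) = X ^+ i * Z ^+ j.
  by rewrite morphM ?groupX // !morphX.
have ZXi i l : (Z ^+ l) ^ (X ^+ i) = Z ^+ (l * t ^ i).
  have := congr1 (coset K) (metacyclic_conj_z i l 0).
  by rewrite mulg1 morphJ ?groupX // !morphX.
have cBX : commute B X.
  apply/commgP/conjg_fixP; rewrite -[X]expg1 /B ZXi expn1 /t mulnDr muln1 expgD -/B.
  by rewrite -(prednK f_gt0) expnS expgM expgM Bp expg1n mulg1.
have cZA : commute Z A.
  apply/commgP/conjg_fixP; rewrite -[Z in LHS]expg1 ZXi mul1n.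
  have [w Dw] := expn_add1_mod2 (p ^ f) p.
  rewrite /t Dw -(prednK f_gt0) expnS -addnA expgD expg1.
  rewrite (_ : _ + _ = p * (p * (p ^ f.-1 + (p ^ f.-1) ^ 2 * w)))%N; last by ring.
  by rewrite 2!expgM Bp expg1n mulg1.
have cAB : commute A B by apply/commute_sym/commuteX.
have Xc : X ^ C = X * Z ^+ d * A ^+ g.
  rewrite -morphJ // xc /= cosetE expgD expgM -/A -!mulgA.
  by rewrite (commuteX2 d g cZA).
have Zc : Z ^ C = Z * A ^+ b * B ^+ a.
  rewrite -morphJ // zc /= cosetE expgD !expgM -/A -/B mulgA.
  by rewrite -(commuteX2 1 b cZA) expg1.
have powp i j : coset K ((x ^+ i * z ^+ j) ^+ p) = A ^+ i * B ^+ j.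
  have [s] := metacyclic_pow_prime 1 i j; rewrite expn1 => ->.
  rewrite cosetE mulnC -mulnA mulnCA !(expgM _ p) -/A -/B mulnDr muln1 mulnCA.
  by rewrite expgD (expgM B p) Bp expg1n mulg1.
have cosetJp y : y \in 'N(K) -> (coset K y ^+ p) ^ C = coset K ((y ^ c) ^+ p).
  by move=> nKy; rewrite morphX ?groupJ // morphJ // conjXg.
have Ac : A ^ C = A * B ^+ d.
  rewrite cosetJp // xc powp.
  by rewrite expgD expgM Ap expg1n mulg1.
have Bc : B ^ C = B.
  rewrite cosetJp // zc powp.
  by rewrite expgD !expgM Ap Bp !expg1n mulg1 mul1g.
(* [C ^+ p] is a product of powers of [A] and [B], both of which commute with [X]. *)
have XCp : X ^ (C ^+ p) = X.
  have Hcp : c ^+ p \in H by apply: subsetP cpK1; exact: Mho_sub.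
  have [i [j Dcp]] := metacyclic_expP Hcp; move: cpK1.
  rewrite Dcp metacyclic_mem_Mho ?(ltnW e_gt1) // expn1.
  move=> /andP[/dvdnP[i' Di] /dvdnP[j' Dj]].
  apply/conjg_fixP/commgP; rewrite -morphX // Dcp /= cosetE Di Dj.
  rewrite ![(_ * p)%N]mulnC !expgM -/A -/B.
  apply: commuteM; first by apply: commuteX; apply: commuteX.
  by apply: commuteX; apply: commute_sym.
have [m Dm] : exists m, ('C(p, 2) = p * m)%N by exists p.-1./2; rewrite bin2odd.
have := conjg_iter_relation cZA cZB cAB Xc Zc Ac Bc p.
(* ['C(p, 2)] is a multiple of [p], hence so is the whole exponent of [A]. *)
have A1 : A ^+ (p * g + b * d * (p * m)) = 1.
  rewrite (_ : _ + _ = p * (g + b * d * m))%N; last by ring.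
  by rewrite expgM Ap expg1n.
rewrite XCp Dm A1 mulg1 expgM -/B -mulgA -expgD => DX.
have: B ^+ (d * (1 + d * b * 'C(p, 3)) + p * (m * (d * (g + a)))) = 1.
  by apply: (mulgI X); rewrite mulg1 {2}DX; congr (_ * _ ^+ _); ring.
move/eqP; rewrite -expgM -[_ ^+ _]mul1g -[1 in X in X == _](expg0 X) eq1 => /andP[_].
by rewrite expnS expn1 dvdn_pmul2l // dvdn_addl // dvdn_mulr.
Qed.

(** The map enters only through [u], which will fix a vertex that [c] moves to another part, so that
    [u] and [u ^ c] generate subgroups meeting trivially. *)
Lemma metacyclic_exponent_obstruction c u : (f < e)%N ->
    c \in 'N(H) -> c ^+ p \in H -> c ^+ (p ^ e) = 1 ->
    u \in H -> #[u] = (p ^ e)%N -> <[u]> :&: <[u ^ c]> = 1 ->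
  p = 3 /\ f = e.-1.
Proof.
move=> lt_fe nHc Hcp cq Hu ou tiu.
have e_gt0 : (0 < e)%N by apply: leq_ltn_trans lt_fe.
have e_gt1 : (1 < e)%N by apply: leq_ltn_trans lt_fe.
have [g [d xc]] : exists g d, x ^ c = x ^+ g * z ^+ d.
  by apply: metacyclic_expP; rewrite memJ_norm ?metacyclic_mem_x.
have [b [a zc]] : exists b a, z ^ c = x ^+ b * z ^+ a.
  by apply: metacyclic_expP; rewrite memJ_norm ?metacyclic_mem_z.
have pef_b := metacyclic_conj_div lt_fe nHc zc.
have p_b : (p %| b)%N.
  by apply: dvdn_trans pef_b; rewrite dvdn_exp // subn_gt0.
have cpK : c ^+ p \in 'Mho^1(H).
  have cpq : (c ^+ p) ^+ (p ^ e.-1) = 1 by rewrite -expgM -expnS prednK.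
  have [i [j ->]] := metacyclic_pow_eq1 e_gt0 Hcp cpq.
  by rewrite metacyclic_mem_Mho // expn1 !dvdn_mulr.
have [g1 a1] := metacyclic_conj_unipotent e_gt0 nHc cpK xc zc p_b.
have p'd := metacyclic_conj_ndvd e_gt0 nHc xc zc p_b g1 a1 Hu ou tiu.
have mod1 n : n = 1 %[mod p] -> n = (1 + p * (n %/ p))%N.
  by move=> n1; rewrite {1}(divn_eq n p) n1 modn_small ?prime_gt1 // addnC mulnC.
have /dvdnP[b' Db] := p_b.
rewrite (mod1 g g1) in xc; rewrite (mod1 a a1) Db mulnC in zc.
have := metacyclic_conj_congruence e_gt1 nHc cpK xc zc.
rewrite Euclid_dvdM // (negPf p'd) /=.
have p_neq1 : p != 1%N by rewrite neq_ltn prime_gt1 ?orbT.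
have [p3 | p_neq3] := eqVneq p 3; last first.
  (* For [p > 3], [p] divides ['C(p, 3)], and the congruence would make [p] divide 1. *)
  rewrite dvdn_addl ?dvdn1 ?(negPf p_neq1) // dvdn_mull // prime_dvd_bin //.
  by move: odd_p (prime_gt1 pr_p) p_neq3; case: (p) => [|[|[|[|]]]].
rewrite p3 binn muln1 -p3 => p_dvd; split=> //.
apply/eqP; rewrite eqn_leq -ltnS prednK // lt_fe /= leqNgt; apply/negP => lt_f.
(* If [f < e.-1], then [p ^ 2] divides [b], and again [p] would divide 1. *)
have p_b' : (p %| b')%N.
  have: (p ^ 2 %| b)%N.
    by apply: dvdn_trans pef_b; rewrite dvdn_exp2l // ltn_subRL addn1 -ltn_predRL.
  by rewrite Db expnS expn1 dvdn_pmul2r ?prime_gt0.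
by move: p_dvd; rewrite dvdn_addl ?dvdn1 ?(negPf p_neq1) // dvdn_mull.
Qed.

End SplitMetacyclic.

(** The order of [s] divides [p * p.-1]![, and as a divisor of]p ^ e[it is prime to]p.-1[!] by
    Wilson's theorem. *)
Lemma prime_perm_exponent p e (s : 'S_p) : prime p -> s ^+ (p ^ e) = 1 -> s ^+ p = 1.
Proof.
move=> pr_p /eqP; rewrite -order_dvdn => s_pe; apply/eqP; rewrite -order_dvdn.
have p_gt0 := prime_gt0 pr_p.
have cop : coprime #[s] p.-1`!.
  apply: (coprime_dvdl s_pe); apply: coprimeXl; rewrite prime_coprime //.
  have := prime_gt1 pr_p; apply: contraL => p_fact; rewrite -leqNgt dvdn_leq //.
  by rewrite -(dvdn_addr 1 p_fact) addn1 -Wilson // prime_gt1.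
rewrite -(Gauss_dvdl _ cop).
have -> : (p * p.-1`! = p`!)%N by case: (p) p_gt0 => // n _; rewrite factS.
by rewrite -card_Sn -cardsT order_dvdG ?inE.
Qed.

(** * Automorphisms of a regular embedding and their action on the parts *)

Section MultipartiteMap.

Variables (m n : nat) (D : finType) (R L : {perm D}) (phi : D -> 'I_m * 'I_n).
Hypotheses (m_gt1 : (1 < m)%N) (n_gt0 : (0 < n)%N).
Hypotheses (regRL : orientably_regular R L) (embRL : embeds_Kmn R L phi).
Local Notation G := (AutP R L).
Local Notation part d := (phi d).1.

Lemma AutP_R g d : g \in G -> g (R d) = R (g d).
Proof. by move=> /centP/(_ R (set21 _ _))/permP/(_ d); rewrite !permM. Qed.

Lemma AutP_L g d : g \in G -> g (L d) = L (g d).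
Proof. by move=> /centP/(_ L (set22 _ _))/permP/(_ d); rewrite !permM. Qed.

Lemma AutP_Rexp g k d : g \in G -> g ((R ^+ k) d) = (R ^+ k) (g d).
Proof.
move=> Gg; elim: k => [|k IHk]; first by rewrite !perm1.
by rewrite expgSr !permM AutP_R ?IHk.
Qed.

Lemma phi_Rexp k d : phi ((R ^+ k) d) = phi d.
Proof.
case: embRL => phiR _ _ _ _; elim: k => [|k IHk]; first by rewrite perm1.
by rewrite expgSr permM phiR.
Qed.

Lemma AutP_vertex g d d' : g \in G -> phi d = phi d' -> phi (g d) = phi (g d').
Proof.
case: embRL => _ orbR _ _ _ Gg /orbR[k <-].
by rewrite AutP_Rexp ?phi_Rexp.
Qed.

Lemma dart_between u v : u.1 != v.1 -> exists2 d, phi d = u & phi (L d) = v.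
Proof.
case: embRL => _ _ _ _ card1 /card1 oD.
have /card_gt0P[d]: (0 < #|[set d | (phi d == u) && (phi (L d) == v)]|)%N.
  by rewrite oD.
by rewrite inE => /andP[/eqP <- /eqP <-]; exists d.
Qed.

Lemma dart_inj d d' : phi d = phi d' -> phi (L d) = phi (L d') -> d = d'.
Proof.
case: embRL => _ _ _ loopless card1 eq0 eq1.
have /eqP/cards1P[d1 /setP Dd1] := card1 _ _ (loopless d).
have := Dd1 d'; have := Dd1 d; rewrite !inE eq0 eq1 !eqxx /=.
by move=> /esym/eqP -> /esym/eqP ->.
Qed.

(** Vertices lie in different parts exactly when a dart joins them, and automorphisms carry darts to
    darts. *)
Lemma AutP_part g d d' : g \in G -> (part (g d) == part (g d')) = (part d == part d').
Proof.
case: embRL => _ _ _ loopless _.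
have sep h d1 d2 : h \in G -> part (h d1) != part (h d2) -> part d1 != part d2.
  move=> Gh /dart_between[d0 phi1 phi2].
  have GV : h^-1 \in G by rewrite groupV.
  have <- : phi (h^-1 d0) = phi d1 by rewrite (AutP_vertex GV phi1) permK.
  have <- : phi (h^-1 (L d0)) = phi d2 by rewrite (AutP_vertex GV phi2) permK.
  by rewrite AutP_L.
move=> Gg; apply: negb_inj; apply/idP/idP; first exact: sep.
by move=> ne; apply: (sep g^-1); rewrite ?groupV // !permK.
Qed.

(** Such a [g] fixes the unique dart joining the two vertices, and the action on darts is free. *)
Lemma AutP_fix_two_vertices g d d' : g \in G -> part d != part d' ->
  phi (g d) = phi d -> phi (g d') = phi d' -> g = 1.
Proof.
case: regRL => _ _ free Gg /dart_between[d0 phi1 phi2] fix1 fix2.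
apply: (free g d0 Gg); apply: dart_inj.
  by rewrite (AutP_vertex Gg phi1) fix1.
by rewrite -AutP_L // (AutP_vertex Gg phi2) fix2.
Qed.

Lemma card_darts_at v : #|[set d | phi d == v]| = (m.-1 * n)%N.
Proof.
case: embRL => _ _ _ loopless _.
rewrite -(card_in_imset (f := phi \o L)); last first.
  by move=> d d'; rewrite !inE => /eqP <- /eqP/esym eqphi; apply: dart_inj.
transitivity #|setX [set~ v.1] [set: 'I_n]|.
  2: by rewrite cardsX cardsC1 cardsT !card_ord.
apply: eq_card => w; rewrite !inE andbT; apply/imsetP/idP.
  by case=> d; rewrite inE => /eqP <- -> /=; rewrite eq_sym.
by rewrite eq_sym => /dart_between[d <- <-]; exists d; rewrite ?inE.
Qed.

Lemma part_action : exists rho : {morphism G >-> {perm 'I_m}},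
  forall g d, g \in G -> rho g (part d) = part (g d).
Proof.
have dart_in i : exists d, part d == i.
  case: embRL => _ _ surj _ _; have [d Dd] := surj (i, Ordinal n_gt0).
  by exists d; rewrite Dd.
pose f (g : {perm D}) i := part (g (xchoose (dart_in i))).
(* The default [1] is never taken on [G], where [f g] is injective. *)
pose rho g := if injectiveP (f g) is ReflectT inj_f then perm inj_f else 1.
have rhoE g d : g \in G -> rho g (part d) = part (g d).
  move=> Gg; have fE : f g (part d) = part (g d).
    by apply/eqP; rewrite /f AutP_part // (eqP (xchooseP (dart_in _))).
  rewrite /rho; case: injectiveP => [inj_f | []]; first by rewrite permE.
  move=> i j /eqP; rewrite /f AutP_part // => /eqP.
  by rewrite !(eqP (xchooseP (dart_in _))).
have rhoM : {in G &, {morph rho : g h / g * h}}.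
  move=> g h Gg Gh; apply/permP=> i; rewrite -(eqP (xchooseP (dart_in i))).
  by rewrite permM !rhoE ?groupM // permM.
by exists (Morphism rhoM).
Qed.

(* A generator [a] of the stabiliser of a vertex permutes the other [m.-1] parts
   cyclically, so that [a ^+ m.-1] preserves every part. *)
Lemma vertex_generator d0 : exists2 u, u \in part_preserving R L phi &
  #[u] = n /\ phi (u d0) = phi d0.
Proof.
have [rho rhoE] := part_action.
case: regRL embRL => _ trans free [phiR orbR _ loopless _].
have [a Ga ad0] := trans d0 (R d0).
have akd0 k : (a ^+ k) d0 = (R ^+ k) d0.
  elim: k => [|k IHk]; first by rewrite !perm1.
  by rewrite expgSr expgS !permM IHk AutP_Rexp // ad0.
(* By freeness a power of [a] is determined by its value at [d0], and these values are all the darts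
   at that vertex. *)
have oa : #[a] = (m.-1 * n)%N.
  rewrite -(card_darts_at (phi d0)) orderE.
  rewrite -(card_in_imset (f := fun g : {perm D} => g d0) (D := <[a]>)).
    apply: eq_card => d; rewrite inE; apply/imsetP/eqP.
      by case=> _ /cycleP[k ->] ->; rewrite akd0 phi_Rexp.
    by move/esym/orbR=> [k <-]; exists (a ^+ k); rewrite ?mem_cycle ?akd0.
  have sAG : <[a]> \subset G by rewrite cycle_subG.
  move=> g h /(subsetP sAG) Gg /(subsetP sAG) Gh eq_gh.
  apply/eqP; rewrite eq_mulgV1; apply/eqP/(free _ d0).
    by rewrite groupM ?groupV.
  by rewrite permM eq_gh permK.
pose u := a ^+ m.-1; have Gu : u \in G by rewrite groupX.
have phiu : phi (u d0) = phi d0 by rewrite /u akd0 phi_Rexp.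
have ou : #[u] = n by rewrite /u orderXdiv oa ?dvdn_mulr // mulKn // -ltnS prednK // ltnW.
exists u => //; rewrite inE Gu; apply/forallP=> d; rewrite -rhoE // morphX //.
have [-> | ne_d] := eqVneq (part d) (part d0).
  by rewrite -morphX // rhoE // phiu.
have orbE : porbit (rho a) (part d) = [set~ part d0].
  apply/setP=> i; rewrite !inE; apply/porbitP/idP => [[k ->] | ne_i].
    rewrite -morphX // rhoE ?groupX //.
    have <- : phi ((a ^+ k) d0) = phi d0 by rewrite akd0 phi_Rexp.
    by rewrite AutP_part ?groupX.
  (* [d1] and [d2] lead from the vertex of [d0] to the part of [d] and to part [i]; a power of [a]
     taking [d1] to [d2] takes the first part to the second. *)
  have [|d1 Dd1 Ld1] := @dart_between (phi d0) (phi d); first by rewrite eq_sym.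
  have [|d2 Dd2 Ld2] := @dart_between (phi d0) (i, (phi d).2); first by rewrite eq_sym.
  have [k Dk] : exists k, (a ^+ k) d1 = d2.
    have [k <-] := orbR d1 d2 (etrans Dd1 (esym Dd2)).
    have [j <-] := orbR d0 d1 (esym Dd1).
    by exists k; rewrite AutP_Rexp ?groupX // akd0 -!permM -!expgD addnC.
  exists k.
  by rewrite -morphX // -Ld1 rhoE ?groupX // AutP_L ?groupX // Dk Ld2.
have := iter_porbit (rho a) (part d); rewrite orbE cardsC1 card_ord => it.
by rewrite permX it.
Qed.

Lemma parts_transitive (rho : {morphism G >-> {perm 'I_m}}) :
  (forall g d, g \in G -> rho g (part d) = part (g d)) -> (m %| #|rho @* G|)%N.
Proof.
move=> rhoE; case: regRL embRL => _ trans _ [_ _ surj _ _].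
have tr : [transitive rho @* G, on [set: 'I_m] | 'P].
  have [d0 Dd0] := surj (Ordinal (ltnW m_gt1), Ordinal n_gt0).
  apply/imsetP; exists (part d0) => //; apply/esym/eqP; rewrite eqEsubset subsetT /=.
  apply/subsetP=> i _; have [d Dd] := surj (i, Ordinal n_gt0).
  have [g Gg gd] := trans d0 d; apply/imsetP; exists (rho g); first exact: mem_morphim.
  by rewrite /= apermE rhoE // gd Dd.
by rewrite -[X in (X %| _)%N]card_ord -cardsT; apply: atrans_dvd tr.
Qed.

Lemma part_preserving_ker (rho : {morphism G >-> {perm 'I_m}}) :
  (forall g d, g \in G -> rho g (part d) = part (g d)) ->
  part_preserving R L phi = 'ker rho.
Proof.
move=> rhoE; case: embRL => _ _ surj _ _; apply/setP=> g; rewrite !inE.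
case Gg: (g \in G) => //=; apply/forallP/eqP=> [ker_g | rho1 d].
  apply/permP=> i; have [d Dd] := surj (i, Ordinal n_gt0).
  by rewrite perm1 -[i]/(i, Ordinal n_gt0).1 -Dd rhoE //; apply/eqP.
by rewrite -rhoE // rho1 perm1.
Qed.

End MultipartiteMap.

(** * From the map to the group-theoretic obstruction *)

Unset Implicit Arguments.

Theorem theorem3p6 (p e f : nat) (D : finType) (R L : {perm D})
    (phi : D -> 'I_p * 'I_(p ^ e)) (H P : {group {perm D}}) :
  prime p -> odd p -> (0 < e)%N ->
  orientably_regular R L ->
  embeds_Kmn R L phi ->
  H :=: part_preserving R L phi ->
  P \in 'Syl_p(AutP R L) ->
  (0 < f <= e)%N ->
  H \isog Grp (x : z : (x ^+ (p ^ e), z ^+ (p ^ e), z ^ x = z ^+ (1 + p ^ f))) ->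
  ~~ abelian H ->
  exponent P = (p ^ e)%N ->
  p = 3 /\ f = e.-1.
Proof.
move=> pr_p odd_p e_gt0 reg emb defH sylP /andP[f_gt0 le_fe] presH nabH expP.
have p_gt1 := prime_gt1 pr_p.
have q_gt0 : (0 < p ^ e)%N by rewrite expn_gt0 prime_gt0.
have [x [z [genH xq zq zx]]] : exists x z, [/\ <[x]> <*> <[z]> = H,
    x ^+ (p ^ e) = 1, z ^+ (p ^ e) = 1 & z ^ x = z ^+ (1 + p ^ f)].
  case/existsP: (isoGrp_hom presH) => -[x z] /= /eqP[genH xq zq zx].
  by exists x, z.
have lt_fe : (f < e)%N.
  rewrite ltn_neqAle le_fe andbT; apply: contra nabH => /eqP eq_fe.
  rewrite -genH abelianY !cycle_abelian cycle_subG; change (z \in 'C(<[x]>)).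
  rewrite cent_cycle.
  apply/cent1P/commgP/conjg_fixP.
  by rewrite zx eq_fe expgD zq mulg1.
have [_ _ surj loopless _] := emb.
have stab := vertex_generator p_gt1 q_gt0 reg emb.
have fix_cycle u d k : u \in AutP R L -> phi (u d) = phi d -> phi ((u ^+ k) d) = phi d.
  move=> Gu ud; elim: k => [|k IHk]; first by rewrite perm1.
  by rewrite expgSr permM (AutP_vertex emb Gu IHk).
have tiv u v d d' : u \in AutP R L -> v \in AutP R L -> (phi d).1 != (phi d').1 ->
    phi (u d) = phi d -> phi (v d') = phi d' -> <[u]> :&: <[v]> = 1.
  move=> Gu Gv ne ud vd; apply/trivgP/subsetP=> _ /setIP[/cycleP[k ->] /cycleP[l Dl]].
  apply/set1gP; apply: (AutP_fix_two_vertices reg emb _ ne).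
  - by rewrite groupX.
  - exact: fix_cycle.
  by rewrite Dl fix_cycle.
have HG u : u \in H -> u \in AutP R L by rewrite defH inE => /andP[].
have oH : #|H| = (p ^ e * p ^ e)%N.
  have [d0 _] := surj (Ordinal (ltnW p_gt1), Ordinal q_gt0).
  have [u Hu [ou ud]] := stab d0; have [v Hv [ov vd]] := stab (L d0).
  rewrite -defH in Hu Hv.
  (* The presentation bounds the order above; the cyclic groups [<[u]>] and [<[v]>], fixing the two
     ends of [d0], bound it below. *)
  apply/eqP; rewrite eqn_leq; apply/andP; split.
    have nZx : <[x]> \subset 'N(<[z]>).
      by have := metacyclic_pow_norm zx 0; rewrite expn0 !expg1.
    rewrite -genH norm_joinEl //.
    rewrite (leq_trans (dvdn_leq _ (dvdn_cardMg _ _))) ?muln_gt0 ?cardG_gt0 //.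
    by rewrite leq_mul // -orderE dvdn_leq // order_dvdn ?xq ?zq.
  rewrite -{1}ou -ov !orderE -TI_cardMg ?(tiv _ _ _ _ _ _ (loopless d0)) ?HG //.
  by rewrite subset_leq_card // mul_subG ?cycle_subG.
have [rho rhoE] := part_action q_gt0 emb.
have kerH : H :=: 'ker rho by rewrite defH (part_preserving_ker q_gt0 emb rhoE).
have p_rho := parts_transitive p_gt1 q_gt0 reg emb rhoE.
rewrite inE in sylP; have [sPG pP _] := and3P sylP.
(* The image of [P] is a Sylow subgroup of [rho @* G], whose order [p] divides, so [P] cannot act
   trivially on the parts. *)
have [c Pc kc] : exists2 c, c \in P & c \notin 'ker rho.
  apply/subsetPn; apply/negP=> sPker.
  have oP1 : #|rho @* P| = 1%N.
    by apply/eqP; rewrite -trivg_card1 -subG1 -(morphim_ker rho) morphimS.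
  have /= := card_Hall (morphim_pHall rho sPG sylP); rewrite oP1.
  by move/esym/eqP; rewrite p_part_eq1 mem_primes pr_p cardG_gt0 p_rho.
have Gc := subsetP sPG c Pc.
have cq : c ^+ (p ^ e) = 1 by rewrite -expP expg_exponent.
have Hcp : c ^+ p \in H.
  rewrite kerH; apply/kerP; rewrite ?groupX // morphX //.
  by apply: (@prime_perm_exponent p e) => //; rewrite -morphX // cq morph1.
have nHc : c \in 'N(H) by rewrite kerH; apply: subsetP Gc; exact: ker_norm.
have [i mv_i] : exists i, rho c i != i.
  apply/existsP; apply: contraR kc => /existsPn fix_c.
  apply/kerP=> //; apply/permP=> i; rewrite perm1; apply/eqP.
  by rewrite -[_ == _]negbK fix_c.
have [d Dd] := surj (i, Ordinal q_gt0); have [u Hu [ou ud]] := stab d.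
rewrite -defH in Hu.
have part_cd : (phi d).1 != (phi (c d)).1 by rewrite -rhoE // Dd eq_sym.
apply: (metacyclic_exponent_obstruction pr_p odd_p f_gt0 genH xq zq zx oH
         (c := c) (u := u)) => //.
apply: (tiv _ _ _ _ _ _ part_cd ud); rewrite ?groupJ ?(HG _ Hu) //.
(* The conjugate [u ^ c] fixes the vertex of [c d], which lies in another part than that of [d]. *)
by rewrite conjgE !permM permK (AutP_vertex emb Gc ud).
Qed.
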